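(* Let $\mathcal H$ be a finite-dimensional real Hilbert space, $\mathcal A:\mathcal H\to 2^{\mathcal H}$ a maximally monotone operator with $\operatorname{zer}\mathcal A\ne\emptyset$, and $\mathcal Q,\mathcal M:\mathcal H\to\mathcal H$ linear operators with $\mathcal M$ invertible. Let $\mathcal T:=(\mathcal A+\mathcal Q)^{-1}\mathcal Q$, $b^0\in\mathcal H$, and $b^{k+1}:=b^k+\mathcal M(\mathcal Tb^k-b^k)$ for $k\in\mathbb N$. Denote $\mathcal S:=\mathcal Q\mathcal M^{-1}$ and $\mathcal G:=\mathcal Q+\mathcal Q^\top-\mathcal M^\top\mathcal Q$. If $\mathcal S$ and $\mathcal G$ are both symmetric positive definite, then the following hold. (i) There exists $b^\star\in\operatorname{zer}\mathcal A$ such that $b^k\to b^\star$ as $k\to\infty$. (ii) For every $b^\star\in\operatorname{zer}\mathcal A$ and every $k\in\mathbb N$, $$\|b^{k+1}-b^k\|_{\mathcal S}\le\frac1{\sqrt{k+1}}\sqrt{\frac{\lambda_{\max}(\mathcal S)}{\lambda_{\min}(\mathcal M^{-\top}\mathcal G\mathcal M^{-1})}}\ \|b^0-b^\star\|_{\mathcal S}.$$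
   Context: $\mathbb N=\{0,1,2,\dots\}$. $\|a\|_{\mathcal S}:=\sqrt{\langle\mathcal Sa,a\rangle}$. $\mathcal M^\top$ is the adjoint and $\mathcal M^{-\top}=(\mathcal M^{-1})^\top$. $\lambda_{\max},\lambda_{\min}$ denote the largest and smallest eigenvalues of a symmetric operator. $\operatorname{zer}\mathcal A:=\{b:0\in\mathcal Ab\}$. $a=\mathcal Tb$ iff $\mathcal Qb\in\mathcal Aa+\mathcal Qa$ (under the stated hypotheses $\mathcal T$ is single-valued with full domain). $\mathcal Q$ is not assumed symmetric. *)

(* Defs.v *)
From HB Require Import structures.
From mathcomp Require Import all_boot all_order all_algebra sesquilinear.
From mathcomp Require Import all_classical all_reals all_analysis.

Set Implicit Arguments.
Unset Strict Implicit.
Unset Printing Implicit Defensive.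

Import Order.TTheory GRing.Theory Num.Theory.
Import numFieldNormedType.Exports.
Import passmx.

Local Open Scope classical_set_scope.
Local Open Scope ring_scope.

(* A finite-dimensional real Hilbert space is a [vectType] over a [realType]
   together with an inner product [dot : {dot H for idfun}]; completeness is
   automatic in finite dimension. *)

Section HilbertOperators.
Context {R : realType} {H : vectType R}.
Variable dot : {dot H for idfun}.

Definition hnorm (x : H) : R := Num.sqrt (dot x x).

Definition wnorm (S : 'End(H)) (x : H) : R := Num.sqrt (dot (S x) x).

(* The set below is a singleton, see [adjointP] and [adjoint_unique]. *)
Definition adjoint (M : 'End(H)) : 'End(H) :=
  xget 0 [set N : 'End(H) | forall x y, dot (M x) y = dot x (N y)].

Definition sym_posdef (S : 'End(H)) : Prop :=
  adjoint S = S /\ forall x, x != 0 -> 0 < dot (S x) x.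

(* Junk value 0 when there is no eigenvalue, i.e. for H = 0 if f is
   symmetric; otherwise see [lambda_maxE] and [lambda_minE]. *)
Definition lambda_max (f : 'End(H)) : R := sup [set l | leigenvalue f l].
Definition lambda_min (f : 'End(H)) : R := inf [set l | leigenvalue f l].

Definition monotone_op (A : H -> set H) : Prop :=
  forall x y u v, A x u -> A y v -> 0 <= dot (x - y) (u - v).

Definition maximally_monotone (A : H -> set H) : Prop :=
  monotone_op A /\
  forall B : H -> set H,
    monotone_op B -> (forall x, A x `<=` B x) -> forall x, B x = A x.

Definition zer (A : H -> set H) : set H := [set b | A b 0].

(* (A + Q)^-1 Q as a set-valued operator: the set of all a such that
   Q b \in A a + Q a. *)
Definition resolvent_op (A : H -> set H) (Q : 'End(H)) (b : H) : set H :=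
  [set a | exists2 u, A a u & Q b = u + Q a].

Definition hcvg (b : nat -> H) (l : H) : Prop :=
  (fun k => hnorm (b k - l)) @ \oo --> (0 : R).

Lemma dot_eq (x y : H) : (forall z, dot z x = dot z y) -> x = y.
Proof.
move=> e; apply/eqP; rewrite -subr_eq0; apply/negPn/negP => n0.
have := @neq0_dnorm_gt0 _ _ _ dot _ n0.
by rewrite linearBr /= e subrr ltxx.
Qed.

Definition gram_fun n (e u : 'I_n -> H) (y : H) : H :=
  \sum_(i < n) dot (u i) y *: e i.

Lemma gram_fun_linear n e u : linear (@gram_fun n e u).
Proof.
move=> a x y; rewrite /gram_fun scaler_sumr -big_split; apply: eq_bigr => i _.
by rewrite linearPr /= scalerDl scalerA.
Qed.

HB.instance Definition _ n e u :=
  GRing.isLinear.Build R H H _ (@gram_fun n e u) (gram_fun_linear e u).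

Lemma adjoint_exists (M : 'End(H)) :
  exists N : 'End(H), forall x y, dot (M x) y = dot x (N y).
Proof.
pose X := vbasis {:H}; pose e i := X`_(nat_of_ord (i : 'I_(\dim {:H}))).
have Xb : basis_of {:H} X := vbasisP _.
have gram0 (c : 'I_(\dim {:H}) -> R) : \sum_i c i *: e i = 0 -> forall i, c i = 0.
  by move: (basis_free Xb) => /freeP; apply.
have dotE (x y : H) : dot x y = \sum_i coord X i x * dot (e i) y.
  rewrite {1}(coord_basis Xb (memvf x)) linear_sumlz.
  by apply: eq_bigr => i _; rewrite linearZl_LR.
pose J := linfun (@gram_fun _ e e).
pose K := linfun (@gram_fun _ e (fun i => M (e i))).
have kJ : lker J == 0%VS.
  apply/lker0P => x y; rewrite !lfunE /= => /eqP.
  rewrite -subr_eq0 -linearB /= => /eqP /gram0 h; apply: dot_eq => z.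
  rewrite !(dotE z); apply: eq_bigr => i _; congr (_ * _); apply/eqP.
  by have /eqP := h i; rewrite linearBr subr_eq0.
exists (J^-1 \o K)%VF => x y; have := lker0_lfunVK kJ (K y).
rewrite comp_lfunE; set z := (_^-1)%VF _.
rewrite !lfunE /= => /eqP; rewrite /gram_fun -subr_eq0 -sumrB => /eqP h.
have {}h i : dot (e i) z = dot (M (e i)) y.
  apply/eqP; rewrite -subr_eq0; apply/eqP; move: i; apply: gram0.
  by rewrite -[RHS]h; apply: eq_bigr => i _; rewrite scalerBl.
rewrite (dotE x) {1}(coord_basis Xb (memvf x)) linear_sum linear_sumlz.
by apply: eq_bigr => i _; rewrite linearZ linearZl_LR h.
Qed.

Lemma adjointP (M : 'End(H)) x y : dot (M x) y = dot x (adjoint M y).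
Proof.
rewrite /adjoint; case: xgetP => [N _ /= -> //|].
by have [N hN] := adjoint_exists M => /(_ N) [].
Qed.

Lemma adjoint_unique (M N : 'End(H)) :
  (forall x y, dot (M x) y = dot x (N y)) -> adjoint M = N.
Proof.
move=> h; apply/lfunP => y; apply: dot_eq => z.
by rewrite -adjointP h.
Qed.

Lemma lambda_maxE (f : 'End(H)) l :
  leigenvalue f l -> (forall m, leigenvalue f m -> m <= l) -> lambda_max f = l.
Proof.
move=> fl ub; apply/eqP; rewrite eq_le; apply/andP; split.
  by apply: ge_sup => //; exists l.
by apply: ub_le_sup => //; exists l.
Qed.

Lemma lambda_minE (f : 'End(H)) l :
  leigenvalue f l -> (forall m, leigenvalue f m -> l <= m) -> lambda_min f = l.
Proof.
move=> fl lb; apply/eqP; rewrite eq_le; apply/andP; split.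
  by apply: ge_inf => //; exists l.
by apply: lb_le_inf => //; exists l.
Qed.

End HilbertOperators.

(* Main.v *)
(* Write [d k = b k - a k] with [a k = T (b k)], so that
   [b k - b k.+1 = M (d k)] and [S (M (d k)) = Q (d k)].  Monotonicity of [A] between [a k] and a zero
   [bstar] gives the Fejer estimate
     |b k.+1 - bstar|_S^2 <= |b k - bstar|_S^2 - <G (d k), d k>,
   and monotonicity between [a k] and [a k.+1] shows that |b k.+1 - b k|_S is
   nonincreasing; summing the former and using the latter yields the rate, the
   constant coming from the Rayleigh bounds on [S] and [M^-T G M^-1].  For the
   convergence, [d k] tends to 0 and [b] is bounded, so any subsequential limit
   is a zero of [A] by maximality, and the Fejer estimate at that limit makes
   the whole sequence converge. *)
Require Import Defs.
From HB Require Import structures.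
From mathcomp Require Import all_boot all_order all_algebra sesquilinear.
From mathcomp Require Import all_classical all_reals all_analysis.
From mathcomp Require Import ring lra.

Import Order.TTheory GRing.Theory Num.Theory.
Import numFieldNormedType.Exports.

Local Open Scope classical_set_scope.
Local Open Scope ring_scope.

Section InnerProduct.
Import passmx.
Set Implicit Arguments.
Unset Strict Implicit.
Context {R : realType} {H : vectType R} {dot : {dot H for idfun}}.
Implicit Types (f g : 'End(H)) (x y z : H) (u v : nat -> H).

(** * Inner product algebra and Cauchy-Schwarz *)

Lemma dotC x y : dot x y = dot y x.
Proof. by rewrite hermC /= expr0 mul1r. Qed.

Lemma dotZl (a : R) x y : dot (a *: x) y = a * dot x y.
Proof. exact: linearZl_LR. Qed.

Lemma dotZr (a : R) x y : dot x (a *: y) = a * dot x y.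
Proof. by rewrite dotC dotZl dotC. Qed.

Lemma dotDl x y z : dot (x + y) z = dot x z + dot y z.
Proof. exact: linearDl. Qed.

Lemma dotDr x y z : dot x (y + z) = dot x y + dot x z.
Proof. by rewrite dotC dotDl !(dotC x). Qed.

Lemma dotNl x y : dot (- x) y = - dot x y.
Proof. exact: linearNl. Qed.

Lemma dotNr x y : dot x (- y) = - dot x y.
Proof. by rewrite dotC dotNl dotC. Qed.

Lemma dotBl x y z : dot (x - y) z = dot x z - dot y z.
Proof. exact: linearBl. Qed.

Lemma dotBr x y z : dot x (y - z) = dot x y - dot x z.
Proof. by rewrite dotDr dotNr. Qed.

Lemma dot_gt0 x : x != 0 -> 0 < dot x x.
Proof. exact: neq0_dnorm_gt0. Qed.

Lemma dot_ge0 x : 0 <= dot x x.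
Proof. by have [->|/dot_gt0/ltW//] := eqVneq x 0; rewrite linear0r. Qed.

Lemma dot_adjoint_sym f x y : adjoint dot f = f -> dot (f x) y = dot (f y) x.
Proof. by move=> fs; rewrite adjointP fs dotC. Qed.

Lemma qformN f x : dot (f (- x)) (- x) = dot (f x) x.
Proof. by rewrite [f _]linearN /= dotNl dotNr opprK. Qed.

Lemma posdef_ge0 f x : sym_posdef dot f -> 0 <= dot (f x) x.
Proof.
by move=> [_ fp]; have [->|/fp/ltW//] := eqVneq x 0; rewrite linear0r.
Qed.

(** Degenerate forms are allowed because [lambda_min_rayleigh] applies this to [f - c] before
    definiteness is known. *)
Lemma bform_CauchySchwarz g x y : adjoint dot g = g ->
  (forall z, 0 <= dot (g z) z) ->
  dot (g x) y ^+ 2 <= dot (g x) x * dot (g y) y.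
Proof.
move=> gs g0; have gsq (s t : R) : 0 <= s ^+ 2 * dot (g x) x
    + 2 * (s * t) * dot (g x) y + t ^+ 2 * dot (g y) y.
  have := g0 (s *: x + t *: y).
  rewrite [g _]linearD /= ![g (_ *: _)]linearZ /= !dotDl !dotDr !dotZl !dotZr.
  by rewrite (dot_adjoint_sym y x gs); lra.
have [c0|c0] := eqVneq (dot (g y) y) 0.
  have [->|b0] := eqVneq (dot (g x) y) 0; first by rewrite expr0n c0 mulr0.
  (* For [s = 1] the expression is now affine in [t]; this [t] gives it the value -1. *)
  have := gsq 1 (- (dot (g x) x + 1) / (2 * dot (g x) y)).
  rewrite c0 !mulr0 addr0 expr1n !mul1r.
  have -> : 2 * (- (dot (g x) x + 1) / (2 * dot (g x) y)) * dot (g x) y =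
            - (dot (g x) x + 1) by field.
  by lra.
have {}c0 : 0 < dot (g y) y by rewrite lt_def c0 g0.
have := gsq (dot (g y) y) (- dot (g x) y).
set a := dot (g x) x; set b := dot (g x) y; set c := dot (g y) y in c0 *.
have -> : c ^+ 2 * a + 2 * (c * - b) * b + (- b) ^+ 2 * c = c * (a * c - b ^+ 2).
  by ring.
by rewrite pmulr_rge0 // subr_ge0.
Qed.

Lemma dot_CauchySchwarz x y : dot x y ^+ 2 <= dot x x * dot y y.
Proof.
have := @bform_CauchySchwarz \1%VF x y; rewrite !id_lfunE; apply.
  by apply: adjoint_unique => u v; rewrite !id_lfunE.
by move=> z; rewrite id_lfunE dot_ge0.
Qed.

(** * Dual basis, boundedness and coercivity of forms *)

(* The Riesz representation of a coordinate form comes from the adjoint of the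
   rank-one map [x |-> coord i x *: e i]. *)
Lemma dual_basis : exists n (e r : 'I_n -> H),
  forall x, x = \sum_i dot x (r i) *: e i.
Proof.
pose X := vbasis {:H}; have Xb : basis_of {:H} X := vbasisP _.
pose e (i : 'I_(\dim {:H})) := X`_i.
exists (\dim {:H}), e.
suff /choice[r rP] : forall i, exists r, forall x, coord X i x = dot x r.
  exists r => x; rewrite {1}(coord_basis Xb (memvf x)).
  by apply: eq_bigr => i _; rewrite rP.
move=> i; pose lin (x : H) : H := coord X i x *: e i.
have linP : linear lin by move=> a x y; rewrite /lin linearP scalerDl scalerA.
pose L := GRing.isLinear.Build R H H _ lin linP.
pose Lin : {linear H -> H} := HB.pack lin L.
exists ((dot (e i) (e i))^-1 *: adjoint dot (linfun Lin) (e i)) => x.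
rewrite dotZr -adjointP lfunE /= /lin dotZl mulrCA mulVf ?mulr1 // gt_eqF //.
apply: dot_gt0; apply/negP => /eqP ei0.
suff : (i == i)%:R = 0 :> R by move=> /eqP; rewrite eqxx oner_eq0.
move: (basis_free Xb) => /freeP /(_ (fun j => (j == i)%:R)); apply.
rewrite (bigD1 i) //= eqxx big1 ?addr0 => [|j /negPf->]; last by rewrite scale0r.
by rewrite [_`_ _]ei0 scaler0.
Qed.

(** Expanding the inner [x] in the dual basis leaves products [<x, r i> <f (e i), x>], each at most
    the sum of the two squares, hence a multiple of [<x, x>] by Cauchy-Schwarz. *)
Lemma qform_bounded f : exists2 C, 0 < C &
  forall x, `|dot (f x) x| <= C * dot x x.
Proof.
have [n [e [r er]]] := dual_basis.
pose C := \sum_i (dot (r i) (r i) + dot (f (e i)) (f (e i))).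
have C0 : 0 <= C by apply: sumr_ge0 => i _; rewrite addr_ge0 ?dot_ge0.
(* Adding 1 keeps the constant positive even when the sum is empty. *)
exists (C + 1) => [|x]; first by rewrite ltr_wpDl.
suff h : `|dot (f x) x| <= C * dot x x by have := dot_ge0 x; lra.
rewrite {1}(er x) [f _]linear_sum /= linear_sumlz mulr_suml.
apply: (le_trans (ler_norm_sum _ _ _)); apply: ler_sum => i _.
rewrite [f _]linearZ /= dotZl.
have h1 := dot_CauchySchwarz x (r i); have h2 := dot_CauchySchwarz (f (e i)) x.
set a := dot x (r i) in h1 *; set b := dot (f (e i)) x in h2 *.
have h3 : `|a * b| <= a ^+ 2 + b ^+ 2 by rewrite ler_norml; apply/andP; split; nra.
by apply: le_trans h3 _; lra.
Qed.

Lemma norm_bounded f : exists2 C, 0 < C &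
  forall x, dot (f x) (f x) <= C * dot x x.
Proof.
have [C C0 hC] := qform_bounded (adjoint dot f \o f)%VF; exists C => // x.
by apply: le_trans (hC x); rewrite adjointP comp_lfunE dotC ler_norm.
Qed.

(* By Cauchy-Schwarz for the form of [g], [|g x|^2 <= C <g x, x>]; the
   inverse of [g] is bounded. *)
Lemma posdef_coercive g : sym_posdef dot g ->
  exists2 c, 0 < c & forall x, c * dot x x <= dot (g x) x.
Proof.
move=> gpd; have [gs gpos] := gpd; have g0 x := posdef_ge0 x gpd.
have gker : lker g == 0%VS.
  apply/lker0P => x y gxy; apply/eqP; rewrite -subr_eq0; apply/negPn/negP.
  by move=> /gpos; rewrite [g _]linearB /= gxy subrr linear0l ltxx.
have [C C0 hC] := qform_bounded g; have [K K0 hK] := norm_bounded g^-1%VF.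
exists (C * K)^-1 => [|x]; first by rewrite invr_gt0 mulr_gt0.
rewrite mulrC ler_pdivrMr ?mulr_gt0 //.
apply: le_trans (_ : K * dot (g x) (g x) <= _).
  by have := hK (g x); rewrite lker0_lfunK.
rewrite [C * K]mulrC mulrCA ler_pM2l //.
have [->|gx0] := eqVneq (g x) 0; first by rewrite !linear0l ?mul0r.
have h := bform_CauchySchwarz x (g x) gs g0.
rewrite -(ler_pM2r (dot_gt0 gx0)) -expr2 (le_trans h) // -mulrA ler_wpM2l //.
exact: le_trans (ler_norm _) (hC _).
Qed.

(** * Eigenvalues and Rayleigh bounds *)

Lemma leigenvalueP f l :
  reflect (exists2 x, x != 0 & f x = l *: x) (leigenvalue f l).
Proof.
apply: (iffP idP) => [|[x x0 fx]].
  rewrite /leigenvalue => e0; exists (vpick (leigenspace f l)).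
    by rewrite vpick0.
  have := memv_pick (leigenspace f l); rewrite memv_ker => /eqP.
  by rewrite !lfun_simp => /eqP; rewrite subr_eq0 => /eqP.
apply: contra x0; rewrite -memv0 => /eqP <-.
by rewrite memv_ker !lfun_simp fx subrr.
Qed.

(* The best constant [c] with [c |x|^2 <= <f x, x>] is an eigenvalue: otherwise
   [f - c] would be positive definite, hence coercive. *)
Lemma lambda_min_rayleigh f x0 : x0 != 0 -> adjoint dot f = f ->
  leigenvalue f (lambda_min f) /\
  forall x, lambda_min f * dot x x <= dot (f x) x.
Proof.
move=> x00 fs; pose T := [set t : R | forall x, t * dot x x <= dot (f x) x].
have [C C0 hC] := qform_bounded f.
have TC : T (- C).
  by move=> x; rewrite mulNr; have := hC x; rewrite ler_norml => /andP[].
have Tub x : x != 0 -> ubound T (dot (f x) x / dot x x).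
  by move=> xn0 t tT; rewrite ler_pdivlMr ?dot_gt0.
(* The nonzero [x0] rules out [H = 0], where [T] would be unbounded. *)
have hT : has_sup T by split; [exists (- C)|eexists; exact: Tub x00].
pose c := sup T.
have cT : T c.
  move=> x; have [->|xn0] := eqVneq x 0; first by rewrite !linear0r ?mulr0.
  by rewrite -ler_pdivlMr ?dot_gt0 // ge_sup //; [exists (- C)|exact: Tub].
have flow l : leigenvalue f l -> c <= l.
  move=> /leigenvalueP[x xn0 fx]; rewrite ge_sup //; first by exists (- C).
  by move=> t /(_ x); rewrite fx dotZl ler_pM2r ?dot_gt0.
suff fc : leigenvalue f c by rewrite (lambda_minE fc flow).
apply: contrapT => /negP nfc; pose g := f - c *: \1%VF.
have gE x : g x = f x - c *: x by rewrite /g !lfun_simp.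
have gs : adjoint dot g = g.
  apply: adjoint_unique => x y.
  by rewrite !gE dotBl dotBr dotZl dotZr adjointP fs.
have g0 x : 0 <= dot (g x) x by rewrite gE dotBl dotZl subr_ge0; exact: cT.
have gpd : sym_posdef dot g.
  split=> // x xn0; rewrite lt_def g0 andbT; apply/negP => /eqP gx0.
  (* A null vector of a semidefinite form lies in its kernel, so [x] would be an eigenvector of [f]
     for [c]. *)
  have := bform_CauchySchwarz x (g x) gs g0.
  rewrite gx0 mul0r => h; have : dot (g x) (g x) == 0.
    by rewrite -sqrf_eq0 eq_le h sqr_ge0.
  apply/negP; rewrite gt_eqF // dot_gt0 //; apply: contra nfc => /eqP gx.
  by apply/leigenvalueP; exists x => //; apply/eqP; rewrite -subr_eq0 -gE gx.
have [d d0 hd] := posdef_coercive gpd.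
have : T (c + d).
  by move=> x; have := hd x; rewrite gE dotBl dotZl; lra.
move=> /(ub_le_sup hT.2); rewrite -/c; lra.
Qed.

Lemma leigenvalueN f l : leigenvalue (- f) l = leigenvalue f (- l).
Proof.
apply/leigenvalueP/leigenvalueP => -[x x0]; rewrite ?lfun_simp => h; exists x => //.
  by rewrite scaleNr -h opprK.
by rewrite lfun_simp h scaleNr opprK.
Qed.

Lemma lambda_max_rayleigh f x0 : x0 != 0 -> adjoint dot f = f ->
  leigenvalue f (lambda_max f) /\
  forall x, dot (f x) x <= lambda_max f * dot x x.
Proof.
move=> x00 fs; have Nfs : adjoint dot (- f) = - f.
  by apply: adjoint_unique => x y; rewrite !lfun_simp dotNl dotNr adjointP fs.
have [e h] := lambda_min_rayleigh x00 Nfs.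
suff -> : lambda_max f = - lambda_min (- f).
  split=> [|x]; first by rewrite -leigenvalueN.
  by rewrite mulNr lerNr -dotNl; have := h x; rewrite lfun_simp.
apply: lambda_maxE; first by rewrite -leigenvalueN.
move=> m fm; rewrite lerNr; apply: ge_inf; last first.
  by rewrite /= leigenvalueN opprK.
exists (lambda_min (- f)) => l /leigenvalueP[x xn0 lx].
by have := h x; rewrite lx dotZl ler_pM2r ?dot_gt0.
Qed.

Lemma posdef_leigenvalue_gt0 f l :
  sym_posdef dot f -> leigenvalue f l -> 0 < l.
Proof.
move=> [_ fp] /leigenvalueP[x xn0 fx]; have := fp _ xn0.
by rewrite fx dotZl pmulr_lgt0 ?dot_gt0.
Qed.

(** * Subsequences and weak convergence *)

Lemma increasing_seq_cvgy (h : nat -> nat) : increasing_seq h -> h @ \oo --> \oo.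
Proof.
move=> hi; have hn n : (n <= h n)%N.
  elim: n => // n IH; apply: leq_ltn_trans IH _.
  by move/increasing_seqP : hi; exact.
apply/cvgnyPge => N; near=> n; apply: leq_trans (hn n).
by near: n; exact: nbhs_infty_ge.
Unshelve. all: by end_near. Qed.

(** Induction on [n]: a subsequence serving all components but the first is refined to serve the
    first, which preserves the limits already found. *)
Lemma bolzano_weierstrass_fin n (u : 'I_n -> nat -> R) :
  (forall i, bounded_fun (u i)) ->
  exists2 h, increasing_seq h & forall i, cvgn (u i \o h).
Proof.
elim: n u => [|n IH] u ub; first by exists id => // -[].
have [h hi hc] := IH (fun i => u (lift ord0 i)) (fun i => ub _).
have /bolzano_weierstrass[g gi gc] : bounded_fun (u ord0 \o h).
  have [M [Mr MP]] := ub ord0; exists M; split => // x Mx k _.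
  exact: (MP x Mx (h k)).
exists (h \o g) => [a b /=|i]; first by rewrite hi; exact: gi.
case: (unliftP ord0 i) => [j ->|-> //].
apply/cvg_ex; exists (limn (u (lift ord0 j) \o h)).
exact: cvg_comp (increasing_seq_cvgy gi) (hc j).
Qed.

(* Weak convergence: equivalent to [hcvg] in finite dimension, but stable under
   linear maps by mere transposition. *)
Definition wcvg u x := forall y, dot (u k) y @[k --> \oo] --> dot x y.

Lemma wcvgD u v x y : wcvg u x -> wcvg v y -> wcvg (fun k => u k + v k) (x + y).
Proof.
move=> ux vy z; rewrite dotDl; under eq_fun do rewrite dotDl.
by apply: cvgD; [exact: ux|exact: vy].
Qed.

Lemma wcvgN u x : wcvg u x -> wcvg (fun k => - u k) (- x).
Proof.
move=> ux z; rewrite dotNl; under eq_fun do rewrite dotNl.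
by apply: cvgN; exact: ux.
Qed.

Lemma wcvg_cst x : wcvg (fun=> x) x.
Proof. by move=> z; exact: cvg_cst. Qed.

Lemma wcvg_lfun f u x : wcvg u x -> wcvg (fun k => f (u k)) (f x).
Proof.
move=> ux z; rewrite adjointP; under eq_fun do rewrite adjointP; exact: ux.
Qed.

Lemma wcvg_subseq (h : nat -> nat) u x :
  increasing_seq h -> wcvg u x -> wcvg (u \o h) x.
Proof. by move=> hi ux z; apply: cvg_comp (increasing_seq_cvgy hi) (ux z). Qed.

(** In a dual basis the inner product is a finite sum of products of convergent scalar sequences. *)
Lemma cvg_dot u v x y : wcvg u x -> wcvg v y ->
  dot (u k) (v k) @[k --> \oo] --> dot x y.
Proof.
move=> ux vy; have [n [e [r er]]] := dual_basis.
have dE s t : dot s t = \sum_i dot s (r i) * dot t (e i).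
  rewrite {1}(er s) linear_sumlz; apply: eq_bigr => i _.
  by rewrite /= dotZl (dotC t).
rewrite dE; under eq_fun do rewrite dE.
apply: (@cvg_big _ _ _ _ _ add_continuous) => i _.
by apply: cvgM; [exact: ux|exact: vy].
Qed.

Lemma cvg_sqrt0 (s : nat -> R) :
  s @ \oo --> (0 : R) -> Num.sqrt (s k) @[k --> \oo] --> (0 : R).
Proof.
move=> s0; have : Num.sqrt (s k) @[k --> \oo] --> Num.sqrt (0 : R).
  exact: (cvg_comp _ _ s0 (@sqrt_continuous R 0)).
by rewrite sqrtr0.
Qed.

Lemma wcvg0 u : dot (u k) (u k) @[k --> \oo] --> (0 : R) -> wcvg u 0.
Proof.
move=> u0 y; rewrite linear0l.
apply/norm_cvg0P.
apply: (@squeeze_cvgr _ _ _ _ (cst 0)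
  (fun k => Num.sqrt (dot (u k) (u k) * dot y y))).
- near=> k; rewrite normr_ge0 -sqrtr_sqr ler_wsqrtr //.
  exact: dot_CauchySchwarz.
- exact: cvg_cst.
apply: cvg_sqrt0; rewrite -(mul0r (dot y y)).
by apply: cvgM => //; exact: cvg_cst.
Unshelve. all: by end_near. Qed.

Lemma bounded_wcvg_subseq u C : (forall k, dot (u k) (u k) <= C) ->
  exists2 h, increasing_seq h & exists x, wcvg (u \o h) x.
Proof.
move=> uC; have [n [e [r er]]] := dual_basis.
have [i|h hi hc] := @bolzano_weierstrass_fin n (fun i k => dot (u k) (r i)).
  have [C0|C0] := leP 0 C; last first.
    by have := le_lt_trans (uC 0%N) C0; rewrite ltNge dot_ge0.
  exists (Num.sqrt (C * dot (r i) (r i))); split; first exact: num_real.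
  move=> x Cx k _; apply: le_trans (ltW Cx); rewrite -sqrtr_sqr ler_wsqrtr //.
  by apply: le_trans (dot_CauchySchwarz _ _) _; rewrite ler_wpM2r ?dot_ge0.
exists h => //; exists (\sum_i limn (fun k => dot (u (h k)) (r i)) *: e i) => y.
rewrite linear_sumlz.
have E k : dot ((u \o h) k) y = \sum_i dot (u (h k)) (r i) * dot (e i) y.
  rewrite /= {1}(er (u (h k))) linear_sumlz; apply: eq_bigr => i _.
  by rewrite /= dotZl.
under eq_fun do rewrite E.
apply: (@cvg_big _ _ _ _ _ add_continuous) => i _; rewrite /= dotZl.
by apply: cvgM; [exact: hc|exact: cvg_cst].
Qed.

(** Adding the pair [(x, w)] to the graph of [A] keeps it monotone, so by maximality it was already
    there. *)
Lemma maximally_monotone_mem (A : H -> set H) (x w : H) :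
  maximally_monotone dot A ->
  (forall y (v : H), A y v -> 0 <= dot (x - y) (w - v)) -> A x w.
Proof.
move=> [Am Amax] xw; pose B y := A y `|` [set v | y = x /\ v = w].
rewrite -(Amax B) //; first by right.
  move=> y z p q [Ay|[-> ->]] [Az|[-> ->]]; first exact: Am.
  - by rewrite -opprB -(opprB w) dotNl dotNr opprK xw.
  - exact: xw.
  - by rewrite !subrr linear0r.
by move=> y v; left.
Qed.

(** * Fejer descent and convergence of the iterates *)

Section Iteration.
Context {A : H -> set H} {Q M : 'End(H)}.
Let S := (Q \o M^-1)%VF.
Let G := Q + adjoint dot Q - (adjoint dot M \o Q)%VF.
Hypothesis M0 : lker M == 0%VS.
Hypotheses (Spd : sym_posdef dot S) (Gpd : sym_posdef dot G).

Lemma S_comp_M d : S (M d) = Q d.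
Proof. by rewrite comp_lfunE lker0_lfunK. Qed.

Lemma qform_G d : dot (G d) d = 2 * dot (Q d) d - dot (Q d) (M d).
Proof.
rewrite /G !lfun_simp dotBl dotDl [dot (adjoint dot Q d) d]dotC -adjointP.
by rewrite [dot (adjoint dot M _) d]dotC -adjointP (dotC (M d)); lra.
Qed.

(* Both the Fejer estimate ([w = b k - bstar]) and the monotonicity of the
   residuals ([w = M (b k - a k)]) are instances of this step. *)
Lemma descent w d : 0 <= dot (w - d) (Q d) ->
  dot (S (w - M d)) (w - M d) <= dot (S w) w - dot (G d) d.
Proof.
(* The left side expands to [<S w, w> - 2 <Q d, w> + <Q d, M d>]; the hypothesis bounds [<Q d, w>]
   below by [<Q d, d>]. *)
rewrite dotBl [S _]linearB /= S_comp_M qform_G !(dotBl, dotBr).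
rewrite (dot_adjoint_sym w (M d) Spd.1) S_comp_M (dotC w) (dotC d); lra.
Qed.

Context {b a : nat -> H}.
Hypothesis Amax : maximally_monotone dot A.
(** The relation [a k = T (b k)], solved for the element of [A (a k)]. *)
Hypothesis aP : forall k, A (a k) (Q (b k - a k)).
Hypothesis bS : forall k, b k.+1 = b k - M (b k - a k).

Let phi bs k := dot (S (b k - bs)) (b k - bs).

Lemma fejer bs k : zer A bs ->
  phi bs k.+1 <= phi bs k - dot (G (b k - a k)) (b k - a k).
Proof.
move=> z0; rewrite /phi; have := @descent (b k - bs) (b k - a k).
have -> : b k - bs - M (b k - a k) = b k.+1 - bs by rewrite bS addrAC.
apply.
have -> : b k - bs - (b k - a k) = a k - bs.
  by rewrite opprB addrC subrKA.
by have := Amax.1 _ _ _ _ (aP k) z0; rewrite subr0.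
Qed.

Lemma phi_nonincreasing bs : zer A bs -> nonincreasing_seq (phi bs).
Proof.
move=> z0; apply/nonincreasing_seqP => k; apply: le_trans (fejer k z0) _.
by rewrite lerBlDr lerDl posdef_ge0.
Qed.

Lemma phi_cvg bs : zer A bs -> cvgn (phi bs).
Proof.
move=> z0; apply: nonincreasing_is_cvgn; first exact: phi_nonincreasing.
by exists 0 => _ [k _ <-]; exact: posdef_ge0.
Qed.

(** The decrements of the convergent sequence [phi bs] tend to 0 and, [G] being coercive, dominate a
    multiple of the squared residual. *)
Lemma residual_wcvg0 : zer A !=set0 -> wcvg (fun k => b k - a k) 0.
Proof.
move=> [bs z0]; apply: wcvg0; have [c c0 hc] := posdef_coercive Gpd.
have pc := phi_cvg z0.
apply: (@squeeze_cvgr _ _ _ _ (cst 0) (fun k => c^-1 * (phi bs k - phi bs k.+1))).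
- near=> k; rewrite dot_ge0 /= -ler_pdivrMl ?invr_gt0 // invrK.
  by apply: le_trans (hc _) _; have := fejer k z0; lra.
- exact: cvg_cst.
rewrite -(mulr0 c^-1) -(subrr (limn (phi bs))).
apply: cvgM; first exact: cvg_cst.
by apply: cvgB => //; rewrite (cvg_shiftS (phi bs)).
Unshelve. all: by end_near. Qed.

Lemma iterates_cvg : zer A !=set0 -> exists2 bs, zer A bs & hcvg dot b bs.
Proof.
move=> zA; have [z z0] := zA; have [c c0 hc] := posdef_coercive Spd.
have [|h hi [x hx]] := @bounded_wcvg_subseq (fun k => b k - z) (c^-1 * phi z 0).
  move=> k; rewrite -ler_pdivrMl ?invr_gt0 // invrK.
  by apply: le_trans (hc _) _; apply: phi_nonincreasing.
have bx : wcvg (b \o h) (x + z).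
  have := wcvgD hx (@wcvg_cst z); congr (wcvg _ _); apply/funext => k.
  by rewrite /= subrK.
have d0 := wcvg_subseq hi (residual_wcvg0 zA).
have ax : wcvg (a \o h) (x + z).
  have := wcvgD bx (wcvgN d0); rewrite oppr0 addr0; congr (wcvg _ _).
  by apply/funext => k; rewrite /= opprB addrC subrK.
(* Monotonicity at [a (h k)] passes to the limit, since [a (h k)] tends to [x + z] and
   [Q (b (h k) - a (h k))] to 0. *)
have zx : zer A (x + z).
  apply: (maximally_monotone_mem Amax) => y v Ayv.
  have u0 := wcvg_lfun (f := Q) d0; rewrite linear0 in u0.
  have := cvg_dot (wcvgD ax (@wcvg_cst (- y))) (wcvgD u0 (@wcvg_cst (- v))).
  move=> cv; rewrite -(cvg_lim _ cv) //.
  apply: limr_ge; first exact: cvgP cv.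
  by near=> k; exact: Amax.1 (aP (h k)) Ayv.
exists (x + z) => //; rewrite /hcvg /hnorm; apply: cvg_sqrt0.
(* The whole sequence converges because [x + z] is a zero; the subsequence identifies its limit. *)
have p0 : phi (x + z) @ \oo --> (0 : R).
  have p1 := phi_cvg zx.
  suff <- : limn (phi (x + z)) = 0 by [].
  have p2 := cvg_comp _ _ (increasing_seq_cvgy hi) p1.
  have bl := wcvgD bx (@wcvg_cst (- (x + z))); rewrite subrr in bl.
  have Sl := wcvg_lfun (f := S) bl; rewrite linear0 in Sl.
  have := cvg_dot Sl bl; rewrite linear0l => p3.
  exact: cvg_unique p2 p3.
apply: (@squeeze_cvgr _ _ _ _ (cst 0) (fun k => c^-1 * phi (x + z) k)).
- near=> k; rewrite dot_ge0 /= -ler_pdivrMl ?invr_gt0 // invrK; exact: hc.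
- exact: cvg_cst.
by rewrite -(mulr0 c^-1); apply: cvgM => //; exact: cvg_cst.
Unshelve. all: by end_near. Qed.

(** * Monotone step lengths and the rate *)

Let E k := dot (S (b k.+1 - b k)) (b k.+1 - b k).

Lemma step_residual k : b k.+1 - b k = - M (b k - a k).
Proof. by rewrite bS addrC addKr. Qed.

Lemma step_nonincreasing k : E k.+1 <= E k.
Proof.
rewrite /E !step_residual !qformN.
(* With this choice [w - M d] is [M (b k.+1 - a k.+1)] and [w - d] is [a k - a k.+1]. *)
have := @descent (M (b k - a k)) ((b k - a k) - (b k.+1 - a k.+1)).
rewrite [M (_ - (b k.+1 - _))]linearB /= subKr => h.
apply: le_trans (h _) _; last by rewrite lerBlDr lerDl posdef_ge0.
have := Amax.1 _ _ _ _ (aP k) (aP k.+1).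
rewrite [Q (_ - (b k.+1 - _))]linearB /=; congr (0 <= dot _ _).
have -> : M (b k - a k) = b k - b k.+1 by rewrite bS subKr.
have -> : b k - a k - (b k.+1 - a k.+1) = b k - b k.+1 - (a k - a k.+1).
  by rewrite !opprD addrACA.
by rewrite subKr.
Qed.

(** The left side is nonincreasing in [k]: each drop of [phi] is at least [rho * E k], which pays
    for the growth of the factor [k], while [E] does not increase. *)
Lemma step_lyapunov bs (rho : R) k : zer A bs -> 0 <= rho ->
  (forall i, rho * E i <= dot (G (b i - a i)) (b i - a i)) ->
  k%:R * (rho * E k) + phi bs k <= phi bs 0.
Proof.
move=> z0 rho0 hrho; elim: k => [|k IH]; first by rewrite mul0r add0r.
have h1 : rho * E k.+1 <= rho * E k by rewrite ler_wpM2l ?step_nonincreasing.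
have h2 := fejer k z0; have h3 := hrho k.
have h4 : k.+1%:R * (rho * E k.+1) <= k.+1%:R * (rho * E k).
  by rewrite ler_wpM2l.
by move: h4; rewrite -natr1; lra.
Qed.

(** The form of [G] in the variable [M d], that is, in terms of the steps of [b]. *)
Let P := (adjoint dot (M^-1) \o G \o M^-1)%VF.

Lemma qform_P x : dot (P x) x = dot (G (M^-1%VF x)) (M^-1%VF x).
Proof. by rewrite /P !comp_lfunE dotC -adjointP dotC. Qed.

Lemma posdef_P : sym_posdef dot P.
Proof.
split=> [|x x0].
  apply: adjoint_unique => x y; rewrite /P !comp_lfunE -adjointP dotC -adjointP.
  by rewrite dotC (dot_adjoint_sym _ _ Gpd.1) dotC.
rewrite qform_P; apply: Gpd.2; apply: contra x0 => /eqP h.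
by rewrite -(lker0_lfunVK M0 x) h linear0.
Qed.

Lemma iterates_rate bs k : zer A bs ->
  wnorm dot S (b k.+1 - b k) <=
    (Num.sqrt k.+1%:R)^-1 * Num.sqrt (lambda_max S / lambda_min P) *
    wnorm dot S (b 0%N - bs).
Proof.
(* A zero step satisfies the bound trivially, whatever the eigenvalues; a nonzero one is the vector
   that the Rayleigh bounds require. *)
move=> z0; have [e0|e0] := eqVneq (b k.+1 - b k) 0.
  by rewrite {1}/wnorm e0 linear0r sqrtr0 !mulr_ge0 ?invr_ge0 ?sqrtr_ge0.
have [eS hS] := lambda_max_rayleigh e0 Spd.1.
have [eP hP] := lambda_min_rayleigh e0 posdef_P.1.
have S0 := posdef_leigenvalue_gt0 Spd eS.
have P0 := posdef_leigenvalue_gt0 posdef_P eP.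
(* For every [y], [rho * <S y, y> <= lambda_min P * <y, y> <= <P y, y>]. *)
pose rho := lambda_min P / lambda_max S.
have rho0 : 0 < rho by rewrite divr_gt0.
have hrho i : rho * E i <= dot (G (b i - a i)) (b i - a i).
  rewrite /E step_residual qformN.
  have := qform_P (M (b i - a i)); rewrite lker0_lfunK // => <-.
  apply: le_trans (hP _); rewrite /rho mulrAC ler_pdivrMr // -mulrA.
  by rewrite ler_pM2l // mulrC hS.
(* The Lyapunov bound supplies the factor [k]; the drop from [phi bs k] to [phi bs k.+1 >= 0]
   supplies one more. *)
have key : k.+1%:R * (rho * E k) <= phi bs 0.
  have := step_lyapunov k z0 (ltW rho0) hrho; have := hrho k; have := fejer k z0.
  by have := posdef_ge0 (b k.+1 - bs) Spd; rewrite -/(phi bs k.+1) -natr1; lra.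
rewrite /wnorm -sqrtrV // -!sqrtrM ?invr_ge0 //; last first.
  by rewrite mulr_ge0 ?invr_ge0 // ltW // divr_gt0.
apply: ler_wsqrtr; rewrite -/(E k) -/(phi bs 0).
rewrite -mulrA -ler_pdivrMl ?invr_gt0 // invrK.
by rewrite -ler_pdivrMl ?divr_gt0 // invf_div mulrCA.
Qed.

End Iteration.
End InnerProduct.

Theorem theorem5p3 (R : realType) (H : vectType R) (dot : {dot H for idfun})
    (A : H -> set H) (Q M : 'End(H)) (b : nat -> H) :
  maximally_monotone dot A ->
  zer A !=set0 ->
  bijective M ->
  (forall k, exists2 a, resolvent_op A Q (b k) a &
                        b k.+1 = b k + M (a - b k)) ->
  let S := (Q \o M^-1)%VF in
  let G := Q + adjoint dot Q - (adjoint dot M \o Q)%VF in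
  sym_posdef dot S ->
  sym_posdef dot G ->
  (exists2 bstar, zer A bstar & hcvg dot b bstar) /\
  (forall bstar k, zer A bstar ->
     wnorm dot S (b k.+1 - b k) <=
       (Num.sqrt k.+1%:R)^-1 *
       Num.sqrt (lambda_max S /
                 lambda_min (adjoint dot (M^-1) \o G \o M^-1)%VF) *
       wnorm dot S (b 0%N - bstar)).
Proof.
move=> Amax zA /bij_inj/lker0P M0 bP S G Spd Gpd.
(* The recurrence only provides some value of the set-valued resolvent at each index; choice
   collects them into a sequence. *)
have /choice[a aP] : forall k, exists a,
    resolvent_op A Q (b k) a /\ b k.+1 = b k + M (a - b k).
  by move=> k; have [a] := bP k; exists a.
have Aa k : A (a k) (Q (b k - a k)).
  by have [[u Au]] := aP k; rewrite [Q (_ - _)]linearB /= => -> _; rewrite addrK.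
have bS k : b k.+1 = b k - M (b k - a k).
  by have [_ ->] := aP k; rewrite -linearN opprB.
split; first exact: (iterates_cvg M0 Spd Gpd Amax Aa bS zA).
by move=> bs k z; exact: (iterates_rate M0 Spd Gpd Amax Aa bS).
Qed.
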